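(* The sequences $T\setminus\lambda\mathcal P$ and $\mathcal T$ are realizations of the double sieve. That is, for each of these two sequences and for every prime $p\in\mathcal P$, the sequence is double sifted by $p$.
   Context: $\mathcal P$ is the set of all primes other than $2$ and $3$. Let $A=(a_i)_{i\ge1}$ with $a_i=6i-1$ and $B=(b_i)_{i\ge1}$ with $b_i=6i+1$. Sieving a sequence by a prime $p$ means replacing by $0$ every composite term that is a multiple of $p$; $S\setminus\lambda\mathcal P$ denotes the sequence $S$ sieved by all $p\in\mathcal P$. Put $\mathcal A=A\setminus\lambda\mathcal P$ and $\mathcal B=B\setminus\lambda\mathcal P$; thus the $i$-th term of $\mathcal A$ is $a_i$ if $a_i$ is prime and $0$ otherwise, and similarly for $\mathcal B$. The difference $S'-S''$ of two sequences $(s'_i)$, $(s''_i)$ is the sequence $(s_i)$ with $s_i=s'_i-s''_i$ if $s'_is''_i\neq0$ and $s_i=0$ if $s'_is''_i=0$. Let $T=B-A$. A sequence that is a sum or difference of two sequences is sieved by sieving both of them, so $T\setminus\lambda\mathcal P=\mathcal B-\mathcal A$; explicitly, its $i$-th term is $2$ if $6i-1$ and $6i+1$ are both prime, and $0$ otherwise. Let $\mathcal L=(l_i)_{i\ge1}$ with $l_i=i$ if $a_i\in\mathcal P$ and $l_i=0$ otherwise, and $\mathcal R=(r_i)_{i\ge1}$ with $r_i=i$ if $b_i\in\mathcal P$ and $r_i=0$ otherwise. Then $\mathcal T=(t_i)_{i\ge1}$ is defined by $t_i=i$ if $l_ir_i\neq0$ and $t_i=0$ if $l_ir_i=0$. For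 a prime $p\in\mathcal P$, $\{0\}_p$ denotes an infinite subsequence of zero terms whose indices form an arithmetic progression with common difference $p$. An infinite sequence $S$ is double sifted by $p$ if there exist two different, disjoint infinite subsequences $\{0\}_p$ of $S$. A sequence $S$ is a realization of the double sieve if it is double sifted by all $p\in\mathcal P$. *)

(* Defs.v *)
From mathcomp Require Import all_boot all_order all_algebra.
From mathcomp Require Import boolp classical_sets.

Set Implicit Arguments.
Unset Strict Implicit.
Unset Printing Implicit Defensive.

Import Order.TTheory GRing.Theory Num.Theory.
Local Open Scope classical_set_scope.
Local Open Scope ring_scope.

Definition calP : pred nat := [pred p | [&& prime p, (p != 2)%N & (p != 3)%N]].

Definition in_calP (z : int) : bool := (0 <= z) && calP `|z|%N.

Definition composite (z : int) : bool := (1 < z) && ~~ prime `|z|%N.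

(* Sequences are indexed by i >= 1: the value at index 0 is junk, and
   [zero_progression] below never uses it. *)
Definition sequence := nat -> int.

Definition seqA : sequence := fun i => 6 * i%:Z - 1.
Definition seqB : sequence := fun i => 6 * i%:Z + 1.

Definition sieve (Q : pred nat) (S : sequence) : sequence := fun i =>
  if `[< exists p : nat, [/\ Q p, composite (S i) & exists m : int, S i = m * p%:Z] >]
  then 0 else S i.

Definition seq_diff (S1 S2 : sequence) : sequence := fun i =>
  if S1 i * S2 i != 0 then S1 i - S2 i else 0.

(* A difference of two sequences is sieved by sieving both operands, so sieving
   is an operation on the pair (S1, S2) and not on the values of
   [seq_diff S1 S2]; for instance [seq_diff seqB seqA] is constantly 2. *)
Definition sieve_diff (Q : pred nat) (S1 S2 : sequence) : sequence :=
  seq_diff (sieve Q S1) (sieve Q S2).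

Definition sievedT : sequence := sieve_diff calP seqB seqA.

Definition seqL : sequence := fun i => if in_calP (seqA i) then i%:Z else 0.
Definition seqR : sequence := fun i => if in_calP (seqB i) then i%:Z else 0.
Definition calT : sequence := fun i => if seqL i * seqR i != 0 then i%:Z else 0.

(* A subsequence is given by its set I of indices. The progression is infinite
   in one direction only and may start at any index i0 >= 1. *)
Definition zero_progression (p : nat) (S : sequence) (I : set nat) : Prop :=
  (exists2 i0 : nat, (0 < i0)%N & I = [set (i0 + k * p)%N | k in [set: nat]]) /\
  (forall i, I i -> S i = 0).

Definition double_sifted (p : nat) (S : sequence) : Prop :=
  exists I J : set nat,
    [/\ zero_progression p S I, zero_progression p S J, I <> J & I `&` J = set0].

Definition double_sieve_realization (S : sequence) : Prop :=
  forall p : nat, calP p -> double_sifted p S.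

(* Main.v *)
From mathcomp Require Import all_boot all_order all_algebra.
From mathcomp Require Import boolp classical_sets zify.
Require Import Defs.

(** For a prime [p >= 5] the congruences [6 i + 1 = 0] and [6 i - 1 = 0] modulo
    [p] have solution classes [c] and [- c], which are disjoint since [p] does
    not divide [2].  As soon as [i >= p], the member of the pair [6 i - 1, 6 i + 1]
    that [p] divides exceeds [p], hence is composite and is sieved out. *)

Set Implicit Arguments.
Unset Strict Implicit.
Unset Printing Implicit Defensive.

Import Order.TTheory GRing.Theory Num.Theory.
Local Open Scope classical_set_scope.
Local Open Scope ring_scope.

Lemma calP_mod6 p : calP p -> (p %% 6 = 1 \/ p %% 6 = 5)%N.
Proof.
case/and3P => pr_p p2 p3.
have n2 : ~~ (2 %| p)%N by rewrite dvdn_prime2 // eq_sym.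
have n3 : ~~ (3 %| p)%N by rewrite dvdn_prime2 // eq_sym.
lia.
Qed.

(** The inverse of [-6] modulo [p] is explicit: if [p = 6m + 1], then [c = m] and [q = 1]; if
    [p = 6m + 5], then [6 (p - m - 1) + 1 = 5p]. *)
Lemma calP_dvd_6addn1 p : calP p ->
  exists c q : nat, (0 < c < p)%N /\ (6 * c + 1 = q * p)%N.
Proof.
move=> Pp; have p_gt1 : (1 < p)%N by case/and3P: Pp => /prime_gt1.
have [p1|p5] := calP_mod6 Pp.
- by exists (p %/ 6)%N, 1%N; lia.
- by exists (p - (p %/ 6).+1)%N, 5%N; lia.
Qed.

Lemma composite_multiple (p : nat) (q : int) :
  prime p -> p%:Z < q * p%:Z -> composite (q * p%:Z).
Proof.
move=> pr_p ltp; have p_gt1 := prime_gt1 pr_p.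
apply/andP; split; first by lia.
apply/negP => pr_qp.
have : (p %| `|(q * p%:Z)%R|)%N by rewrite abszM dvdn_mull.
rewrite dvdn_prime2 // => /eqP; lia.
Qed.

Lemma sieve_multiple (p : nat) (S : sequence) i (q : int) :
  calP p -> S i = q * p%:Z -> p%:Z < S i -> sieve calP S i = 0.
Proof.
move=> Pp Si ltp; rewrite /sieve asboolT //.
exists p; split=> //; last by exists q.
by rewrite Si composite_multiple -?Si //; case/and3P: Pp.
Qed.

Lemma in_calP_multiple (p : nat) (z q : int) :
  calP p -> z = q * p%:Z -> p%:Z < z -> in_calP z = false.
Proof.
case/and3P => pr_p _ _ -> /(composite_multiple pr_p) /andP[_ /negbTE npr].
by rewrite /in_calP /calP /= npr andbF.
Qed.

(** Common core for both sequences. The single bound [p < seqA i] also covers multiples of [p] in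
    [seqB], whose terms are larger. *)
Lemma double_sifted_multiples (p : nat) (S : sequence) : calP p ->
    (forall i (q : int), p%:Z < seqA i ->
       seqA i = q * p%:Z \/ seqB i = q * p%:Z -> S i = 0) ->
  double_sifted p S.
Proof.
move=> Pp S0; have [c [q [/andP[c_gt0 c_ltp] cq]]] := calP_dvd_6addn1 Pp.
have p_gt2 : (2 < p)%N.
  by case/and3P: Pp => /prime_gt1 + + _; lia.
(* The extra [p] skips the first index of each class, where the multiple may be the prime [p]
   itself, which survives the sieve. *)
pose I := [set (c + p + k * p)%N | k in [set: nat]].
pose J := [set (p - c + p + k * p)%N | k in [set: nat]].
have IJ0 : I `&` J = set0.
  rewrite -subset0 => i [[k _ <-] [l _]] /(congr1 (muln 6)).
  (* Modulo [p], [6i + 6c + 2 = (6i + 1) + (6c + 1)] is [0] on [I] and [2] on [J]; these differ as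
     [p > 2]. *)
  move=> /(congr1 (fun n => (n + 6 * c + 2) %% p)%N).
  have -> : (6 * (p - c + p + l * p) + 6 * c + 2 = (12 + 6 * l) * p + 2)%N by nia.
  have -> : (6 * (c + p + k * p) + 6 * c + 2 = (2 * q + 6 + 6 * k) * p)%N by nia.
  by rewrite modnMl modnMDl modn_small.
exists I, J; split=> //.
- split; first by exists (c + p)%N; [lia|].
  move=> _ [k _ <-]; apply: (S0 _ (q + 6 + 6 * k)%N%:Z); first by rewrite /seqA; nia.
  by right; rewrite /seqB; nia.
- split; first by exists (p - c + p)%N; [lia|].
  (* For [i = 2p - c + kp], [6i - 1 = (12 + 6k) p - (6c + 1)], and [6c + 1 = qp]. *)
  move=> _ [k _ <-]; apply: (S0 _ (12 + 6 * k%:Z - q%:Z)).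
    by rewrite /seqA; nia.
  by left; rewrite /seqA; nia.
- move=> IJ; have : (I `&` J) (c + p)%N.
    by rewrite -IJ setIid; exists 0%N => //; rewrite mul0n addn0.
  by rewrite IJ0.
Qed.

Theorem theorem9 :
  double_sieve_realization sievedT /\ double_sieve_realization calT.
Proof.
have ltAB i : seqA i < seqB i by rewrite /seqA /seqB; lia.
split=> p Pp; apply: double_sifted_multiples => // i q ltp [Ai|Bi].
- by rewrite /sievedT /sieve_diff /seq_diff (sieve_multiple Pp Ai) // mulr0 eqxx.
- rewrite /sievedT /sieve_diff /seq_diff (sieve_multiple Pp Bi) ?mul0r ?eqxx //.
  exact: lt_trans ltp (ltAB i).
- by rewrite /calT /seqL (in_calP_multiple Pp Ai) // mul0r eqxx.
- rewrite /calT /seqR (in_calP_multiple Pp Bi) ?mulr0 ?eqxx //.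
  exact: lt_trans ltp (ltAB i).
Qed.
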